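(* Let $((E^n,\|\cdot\|_n):n\in\mathbb N)$ and $((F^n,\|\cdot\|_n):n\in\mathbb N)$ be two multi-normed spaces. Suppose that the multi-norm based on $F$ is the minimum multi-norm, or that the multi-norm based on $E$ is the maximum multi-norm. Then $\mathcal M(E,F)=\mathcal B(E,F)$ and $\|T\|_{mb}=\|T\|$ for each $T\in\mathcal B(E,F)$.
   Context: All spaces are complex. A multi-norm based on a normed space $(E,\|\cdot\|)$ is a sequence $(\|\cdot\|_k:k\in\mathbb N)$, with $\|\cdot\|_k$ a norm on $E^k$ and $\|x\|_1=\|x\|$, such that for each $k\ge2$: (A1) $\|(x_{\sigma(1)},\dots,x_{\sigma(k)})\|_k=\|(x_1,\dots,x_k)\|_k$ for each permutation $\sigma$ of $\{1,\dots,k\}$; (A2) $\|(\alpha_1x_1,\dots,\alpha_kx_k)\|_k\le(\max_i|\alpha_i|)\|(x_1,\dots,x_k)\|_k$ for $\alpha_i\in\mathbb C$; (A3) $\|(x_1,\dots,x_{k-1},0)\|_k=\|(x_1,\dots,x_{k-1})\|_{k-1}$; (A4) $\|(x_1,\dots,x_{k-2},x_{k-1},x_{k-1})\|_k=\|(x_1,\dots,x_{k-1})\|_{k-1}$, for all $x_i\in E$. Then $((E^n,\|\cdot\|_n):n\in\mathbb N)$ is a multi-normed space. The minimum multi-norm is $\|(x_1,\dots,x_n)\|_n^{\min}=\max_i\|x_i\|$; the maximum multi-norm is the pointwise supremum of all multi-norms based on $E$ (it is itself a multi-norm). A subset $B$ of $E$ is multi-bounded if $c_B:=\sup\{\|(x_1,\dots,x_n)\|_n:x_1,\dots,x_n\in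 B,\ n\in\mathbb N\}<\infty$. A linear map $T:E\to F$ between multi-normed spaces is multi-bounded if $T(B)$ is multi-bounded in $F$ for each multi-bounded $B\subset E$; $\mathcal M(E,F)$ is the linear space of such maps, and $\|T\|_{mb}=\sup\{c_{T(B)}:B\subset E\text{ multi-bounded},\ c_B\le1\}$ (which is finite). $\mathcal B(E,F)$ is the space of bounded linear operators, with operator norm $\|\cdot\|$. *)

(* Defs.v *)
From HB Require Import structures.
From mathcomp Require Import all_boot all_order all_fingroup all_algebra.
From mathcomp Require Import all_classical all_reals all_analysis.
From mathcomp Require Import complex.

Set Implicit Arguments.
Unset Strict Implicit.
Unset Printing Implicit Defensive.

Import Order.TTheory GRing.Theory Num.Theory.
Import numFieldNormedType.Exports.

Local Open Scope classical_set_scope.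
Local Open Scope ring_scope.

(* The norm of a [normedModType R[i]] takes values in R[i] (they are real and
   nonnegative); [rnorm] reads it in R. It also applies to scalars in R[i]. *)
Definition rnorm (R : realType) (V : normedZmodType R[i]) (x : V) : R :=
  complex.Re `|x|.

Definition is_norm (R : realType) (V : lmodType R[i]) (N : V -> R) : Prop :=
  [/\ forall x y, N (x + y) <= N x + N y,
      forall (a : R[i]) x, N (a *: x) = rnorm a * N x
    & forall x, N x = 0 -> x = 0].

(* (x_1, ..., x_{k+1}) |-> (x_1, ..., x_k) *)
Definition init (T : Type) (k : nat) (x : {ffun 'I_k.+1 -> T}) :
    {ffun 'I_k -> T} :=
  [ffun i => x (lift ord_max i)].

(* Indices are shifted by one: [mnorm k] is the norm on E^(k+1), so the axioms
   stated on E^(k+2) are those required for all exponents >= 2. *)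
Record multinorm (R : realType) (E : normedModType R[i]) := MultiNorm {
  mnorm :> forall k : nat, {ffun 'I_k.+1 -> E} -> R;
  mnorm_is_norm : forall k : nat, is_norm (@mnorm k);
  mnorm_base : forall x : {ffun 'I_1 -> E}, mnorm x = rnorm (x ord0);
  mnorm_perm : forall (k : nat) (s : 'S_k.+2) (x : {ffun 'I_k.+2 -> E}),
    mnorm [ffun i => x (s i)] = mnorm x;
  mnorm_scale : forall (k : nat) (a : 'I_k.+2 -> R[i])
      (x : {ffun 'I_k.+2 -> E}),
    mnorm [ffun i => a i *: x i]
      <= (\big[Num.max/0]_(i < k.+2) rnorm (a i)) * mnorm x;
  mnorm_zero : forall (k : nat) (x : {ffun 'I_k.+2 -> E}),
    x ord_max = 0 -> mnorm x = mnorm (init x);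
  (* [init x ord_max] is the last but one entry of x. *)
  mnorm_dup : forall (k : nat) (x : {ffun 'I_k.+2 -> E}),
    x ord_max = init x ord_max -> mnorm x = mnorm (init x)
}.

Definition is_min_multinorm (R : realType) (E : normedModType R[i])
    (N : multinorm E) : Prop :=
  forall (k : nat) (x : {ffun 'I_k.+1 -> E}),
    N k x = \big[Num.max/0]_(i < k.+1) rnorm (x i).

Definition is_max_multinorm (R : realType) (E : normedModType R[i])
    (N : multinorm E) : Prop :=
  forall (k : nat) (x : {ffun 'I_k.+1 -> E}),
    (N k x)%:E = ereal_sup [set (N' k x)%:E | N' in [set: multinorm E]].

(* c_B. For B empty this is -oo instead of 0; the empty set is multi-bounded
   either way, and it does not affect [mb_norm] since [set 0] has constant 0. *)
Definition mconst (R : realType) (E : normedModType R[i]) (N : multinorm E)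
    (B : set E) : \bar R :=
  ereal_sup [set c | exists (k : nat) (x : {ffun 'I_k.+1 -> E}),
                       (forall i, B (x i)) /\ c = (N k x)%:E].

Definition multi_bounded_set (R : realType) (E : normedModType R[i])
    (N : multinorm E) (B : set E) : Prop :=
  (mconst N B < +oo)%E.

Definition multi_bounded (R : realType) (E F : normedModType R[i])
    (NE : multinorm E) (NF : multinorm F) (T : {linear E -> F}) : Prop :=
  forall B : set E, multi_bounded_set NE B -> multi_bounded_set NF (T @` B).

Definition mb_norm (R : realType) (E F : normedModType R[i])
    (NE : multinorm E) (NF : multinorm F) (T : {linear E -> F}) : \bar R :=
  ereal_sup [set mconst NF (T @` B) |
    B in [set B | multi_bounded_set NE B /\ (mconst NE B <= 1)%E]].

Definition bounded_operator (R : realType) (E F : normedModType R[i])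
    (T : {linear E -> F}) : Prop :=
  exists M : R, forall x : E, rnorm (T x) <= M * rnorm x.

Definition op_norm (R : realType) (E F : normedModType R[i])
    (T : {linear E -> F}) : \bar R :=
  ereal_sup [set (rnorm (T x))%:E | x in [set x : E | rnorm x <= 1]].

(* Main.v *)
(* A bounded T satisfies c_{T(B)} <= M c_B as soon as M > 0 and
   |T x| <= M |x|. For a minimum multi-norm on F this holds because only the
   norms of the entries matter. For a maximum multi-norm on E it holds because
   x |-> max(|x|_k, |Tx|_k / M) is again a multi-norm based on E. Letting M
   decrease to |T| gives |T|_mb <= |T|; singletons give the converse. *)
Require Import Defs.
From HB Require Import structures.
From mathcomp Require Import all_boot all_order all_fingroup all_algebra.
From mathcomp Require Import all_classical all_reals all_analysis.
From mathcomp Require Import complex.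

Set Implicit Arguments.
Unset Strict Implicit.
Unset Printing Implicit Defensive.

Import Order.TTheory GRing.Theory Num.Theory.
Import numFieldNormedType.Exports.

Local Open Scope classical_set_scope.
Local Open Scope ring_scope.

(** * Norms read in the reals *)

Lemma rnorm_complexE (R : realType) (V : normedZmodType R[i]) (x : V) :
  `|x| = ((rnorm x)%:C)%C.
Proof.
have := normr_ge0 x; rewrite /rnorm lecE => /andP[/eqP /= im0 _].
by case: (`|x|) im0 => a b /= ->.
Qed.

Lemma rnorm_ge0 (R : realType) (V : normedZmodType R[i]) (x : V) : 0 <= rnorm x.
Proof. by have := normr_ge0 x; rewrite lecE => /andP[]. Qed.

Lemma rnorm0 (R : realType) (V : normedZmodType R[i]) : rnorm (0 : V) = 0.
Proof. by rewrite /rnorm normr0. Qed.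

Lemma rnorm0_eq0 (R : realType) (V : normedZmodType R[i]) (x : V) :
  rnorm x = 0 -> x = 0.
Proof. by move=> x0; apply/normr0_eq0; rewrite rnorm_complexE x0. Qed.

Lemma rnormZ (R : realType) (V : normedModType R[i]) (a : R[i]) (x : V) :
  rnorm (a *: x) = rnorm a * rnorm x.
Proof.
by rewrite {1}/rnorm normrZ !rnorm_complexE /= mulr0 subr0.
Qed.

Lemma rnorm_real (R : realType) (a : R) : 0 <= a -> rnorm ((a%:C)%C : R[i]) = a.
Proof. by move=> a0; rewrite /rnorm ger0_norm // lecE /= eqxx. Qed.

Section IsNorm.
Variables (R : realType) (V : lmodType R[i]) (N : V -> R).
Hypothesis normN : is_norm N.

Lemma is_norm0 : N 0 = 0.
Proof. by case: normN => _ NZ _; rewrite -(scale0r 0) NZ rnorm0 mul0r. Qed.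

(** Follows from 0 = N (x - x) <= N x + N x. *)
Lemma is_norm_ge0 x : 0 <= N x.
Proof.
case: (normN) => ND NZ _.
have := ND x (- 1 *: x); rewrite NZ scaleN1r subrr is_norm0.
suff -> : rnorm (- 1 : R[i]) = 1 by rewrite mul1r -mulr2n pmulrn_lge0.
by rewrite /rnorm normrN normr1.
Qed.

Lemma is_norm_sum (I : Type) (r : seq I) (P : pred I) (f : I -> V) :
  N (\sum_(i <- r | P i) f i) <= \sum_(i <- r | P i) N (f i).
Proof.
case: (normN) => ND _ _; elim/big_ind2: _ => //; first by rewrite is_norm0.
by move=> x a y b xa yb; apply: le_trans (ND _ _) _; apply: lerD.
Qed.

End IsNorm.

(** * Estimates in a single multi-norm, and the constants of sets *)

Section Multinorm.
Variables (R : realType) (E : normedModType R[i]) (N : multinorm E).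

(** Axiom (A4) removes the repeated entries one at a time, down to a single one. *)
Lemma mnorm_cst k (v : E) : N k [ffun=> v] = rnorm v.
Proof.
elim: k => [|k IHk]; first by rewrite mnorm_base ffunE.
rewrite mnorm_dup; last by rewrite !ffunE.
by rewrite -IHk; congr (N _ _); apply/ffunP => i; rewrite !ffunE.
Qed.

(** The tuple is a constant tuple with coefficients 0 and 1, so (A2) bounds it by the norm of the
    constant tuple. *)
Lemma mnorm_indicator k (P : pred 'I_k.+1) (v : E) :
  N k [ffun i => if P i then v else 0] <= rnorm v.
Proof.
(* [mnorm_scale] starts with pairs; a single entry is covered by [mnorm_base]. *)
case: k P => [|k] P.
  by rewrite mnorm_base ffunE; case: ifP => // _; rewrite rnorm0 rnorm_ge0.
have -> : [ffun i => if P i then v else 0] =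
    [ffun i => (P i)%:R *: [ffun=> v] i] :> {ffun 'I_k.+2 -> E}.
  by apply/ffunP => i; rewrite !ffunE; case: (P i); rewrite ?scale1r ?scale0r.
apply: le_trans (mnorm_scale _ _ _) _.
rewrite mnorm_cst ler_piMl ?rnorm_ge0 //.
elim/big_ind: _ => [|x y x1 y1|i _]; first exact: ler01.
  by rewrite ge_max x1.
by case: (P i); rewrite /rnorm ?normr1 ?normr0 /= ?ler01.
Qed.

(** Grouping the positions by the value of [f] writes the tuple as a sum of indicator tuples, one
    for each n < m. Each [y n] is thus paid for once, however often it is repeated, and the bound
    does not depend on [k]. *)
Lemma mnorm_le_sum_range k (y : nat -> E) (f : 'I_k.+1 -> nat) m :
    (forall i, f i < m)%N ->
  N k [ffun i => y (f i)] <= \sum_(n < m) rnorm (y n).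
Proof.
move=> fm.
have -> : [ffun i => y (f i)] =
    \sum_(n < m) [ffun i => if f i == n then y n else 0].
  apply/ffunP => i; rewrite sum_ffunE ffunE (bigD1 (Ordinal (fm i))) //=.
  rewrite ffunE eqxx big1 ?addr0 // => n ni; rewrite ffunE ifN //.
  by apply: contra ni => /eqP fin; apply/eqP/val_inj.
apply: le_trans (is_norm_sum (mnorm_is_norm N k) _ _ _) _.
by apply: ler_sum => n _; apply: mnorm_indicator.
Qed.

Lemma mnorm_le_mconst (B : set E) k (x : {ffun 'I_k.+1 -> E}) :
  (forall i, B (x i)) -> ((N k x)%:E <= mconst N B)%E.
Proof. by move=> Bx; apply: ereal_sup_ubound; exists k, x. Qed.

Lemma rnorm_le_mconst (B : set E) v : B v -> ((rnorm v)%:E <= mconst N B)%E.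
Proof.
move=> Bv; rewrite -(mnorm_cst 0); apply: mnorm_le_mconst => i.
by rewrite ffunE.
Qed.

Lemma mconst_le (B : set E) (c : \bar R) :
    (forall k (x : {ffun 'I_k.+1 -> E}),
      (forall i, B (x i)) -> ((N k x)%:E <= c)%E) ->
  (mconst N B <= c)%E.
Proof. by move=> Bc; apply: ge_ereal_sup => _ [k [x [Bx ->]]]; apply: Bc. Qed.

Lemma mconst_set1 v : mconst N [set v] = (rnorm v)%:E.
Proof.
apply/eqP; rewrite eq_le rnorm_le_mconst // andbT.
apply: mconst_le => k x xv; rewrite -(mnorm_cst k) lee_fin.
suff -> : x = [ffun=> v] by [].
by apply/ffunP => i; rewrite ffunE (xv i).
Qed.

Lemma multi_bounded_setP (B : set E) :
  multi_bounded_set N B <-> exists c : R, (mconst N B <= c%:E)%E.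
Proof.
rewrite /multi_bounded_set; split=> [|[c Bc]]; last first.
  exact: le_lt_trans Bc (ltry _).
case: (mconst N B) => [r _|//|_]; first by exists r.
(* The value -oo, which occurs for empty [B]. *)
by exists 0; rewrite leNye.
Qed.

End Multinorm.

(** * The multi-norm on [E] induced by an operator *)

Section Pullback.
Variables (R : realType) (E F : normedModType R[i]).
Variables (NE : multinorm E) (NF : multinorm F) (T : {linear E -> F}) (c : R).
Hypotheses (c_ge0 : 0 <= c) (cT : forall x, c * rnorm (T x) <= rnorm x).

(** Here [c] plays the role of 1 / M. The second term alone is only a seminorm when [T] has a
    kernel; the maximum with [NE] restores definiteness and the right norm on single vectors. *)
Definition pull_mnorm k (x : {ffun 'I_k.+1 -> E}) : R :=
  Num.max (NE k x) (c * NF k [ffun i => T (x i)]).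

Lemma pull_mnorm_is_norm k : is_norm (@pull_mnorm k).
Proof.
have normE := mnorm_is_norm NE k; have normF := mnorm_is_norm NF k.
case: (normE) (normF) => ED EZ E0 [FD FZ _]; split.
- move=> x y; rewrite /pull_mnorm ge_max; apply/andP; split.
    by apply: le_trans (ED _ _) _; apply: lerD; rewrite le_max lexx.
  have -> : [ffun i => T ((x + y) i)] =
      [ffun i => T (x i)] + [ffun i => T (y i)].
    by apply/ffunP => i; rewrite !ffunE linearD.
  apply: le_trans (ler_wpM2l c_ge0 (FD _ _)) _; rewrite mulrDr.
  by apply: lerD; rewrite le_max lexx orbT.
- move=> a x; rewrite /pull_mnorm EZ.
  have -> : [ffun i => T ((a *: x) i)] = a *: [ffun i => T (x i)].
    by apply/ffunP => i; rewrite !ffunE linearZ.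
  by rewrite FZ mulrCA maxr_pMr ?rnorm_ge0.
- move=> x x0; apply: E0; apply/eqP.
  by rewrite eq_le (is_norm_ge0 normE) andbT -x0 le_max lexx.
Qed.

(** This is where [cT] enters: on single vectors the first term of the maximum wins. *)
Lemma pull_mnorm_base (x : {ffun 'I_1 -> E}) : pull_mnorm x = rnorm (x ord0).
Proof. by rewrite /pull_mnorm !mnorm_base ffunE; apply/max_idPl. Qed.

Lemma pull_mnorm_perm k (s : 'S_k.+2) (x : {ffun 'I_k.+2 -> E}) :
  pull_mnorm [ffun i => x (s i)] = pull_mnorm x.
Proof.
rewrite /pull_mnorm mnorm_perm -(mnorm_perm NF s [ffun i => T (x i)]).
by congr (Num.max _ (_ * NF _ _)); apply/ffunP => i; rewrite !ffunE.
Qed.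

Lemma pull_mnorm_scale k (a : 'I_k.+2 -> R[i]) (x : {ffun 'I_k.+2 -> E}) :
  pull_mnorm [ffun i => a i *: x i]
    <= (\big[Num.max/0]_(i < k.+2) rnorm (a i)) * pull_mnorm x.
Proof.
have max_ge0 : 0 <= \big[Num.max/0]_(i < k.+2) rnorm (a i).
  by elim/big_ind: _ => // *; [rewrite le_max; apply/orP; left|exact: rnorm_ge0].
rewrite /pull_mnorm maxr_pMr // ge_max; apply/andP; split.
  by apply: le_trans (mnorm_scale _ _ _) _; rewrite le_max lexx.
rewrite le_max; apply/orP; right; rewrite mulrCA; apply: ler_wpM2l => //.
have -> : [ffun i => T ([ffun i0 => a i0 *: x i0] i)] =
    [ffun i => a i *: [ffun i => T (x i)] i].
  by apply/ffunP => i; rewrite !ffunE linearZ.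
exact: mnorm_scale.
Qed.

Let init_comp k (x : {ffun 'I_k.+1 -> E}) :
  init [ffun i => T (x i)] = [ffun i => T (init x i)].
Proof. by apply/ffunP => i; rewrite !ffunE. Qed.

Lemma pull_mnorm_zero k (x : {ffun 'I_k.+2 -> E}) :
  x ord_max = 0 -> pull_mnorm x = pull_mnorm (init x).
Proof.
move=> x0; rewrite /pull_mnorm mnorm_zero // [NF _ _]mnorm_zero ?init_comp //.
by rewrite ffunE x0 linear0.
Qed.

Lemma pull_mnorm_dup k (x : {ffun 'I_k.+2 -> E}) :
  x ord_max = init x ord_max -> pull_mnorm x = pull_mnorm (init x).
Proof.
move=> xx; rewrite /pull_mnorm mnorm_dup // [NF _ _]mnorm_dup ?init_comp //.
by rewrite !ffunE xx ffunE.
Qed.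

Definition pull_multinorm : multinorm E :=
  MultiNorm pull_mnorm_is_norm pull_mnorm_base pull_mnorm_perm
    pull_mnorm_scale pull_mnorm_zero pull_mnorm_dup.

End Pullback.

(** * Comparison of bounded and multi-bounded operators *)

Section MultiBounded.
Variables (R : realType) (E F : normedModType R[i]).
Variables (NE : multinorm E) (NF : multinorm F) (T : {linear E -> F}).

Lemma bigmax_rnorm_le k (x : 'I_k.+1 -> F) (c : R) :
  (forall i, rnorm (x i) <= c) -> \big[Num.max/0]_(i < k.+1) rnorm (x i) <= c.
Proof.
(* The iterated maximum starts at 0, so [c] must be nonnegative; the entry at [ord0] ensures it. *)
move=> xc; have c0 : 0 <= c := le_trans (rnorm_ge0 _) (xc ord0).
by elim/big_ind: _ => // a b ac bc; rewrite ge_max ac.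
Qed.

Lemma is_max_mnorm_image (M : R) :
    is_max_multinorm NE -> 0 < M ->
    (forall x, rnorm (T x) <= M * rnorm x) ->
  forall k (x : {ffun 'I_k.+1 -> E}),
    NF k [ffun i => T (x i)] <= M * NE k x.
Proof.
move=> maxE M0 TM k x; have Mi0 : 0 <= M^-1 by rewrite invr_ge0 ltW.
have cT y : M^-1 * rnorm (T y) <= rnorm y by rewrite ler_pdivrMl.
(* The maximum multi-norm dominates the pullback with constant [M^-1], hence also the second term of
   its maximum. *)
have : ((pull_multinorm NE NF Mi0 cT k x)%:E <= (NE k x)%:E)%E.
  by rewrite maxE; apply: ereal_sup_ubound; exists (pull_multinorm NE NF Mi0 cT).
by rewrite lee_fin /= ge_max => /andP[_]; rewrite ler_pdivrMl.
Qed.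

Lemma mconst_image_le (M c : R) (B : set E) :
    is_min_multinorm NF \/ is_max_multinorm NE -> 0 < M ->
    (forall x, rnorm (T x) <= M * rnorm x) -> (mconst NE B <= c%:E)%E ->
  (mconst NF (T @` B) <= (M * c)%:E)%E.
Proof.
move=> minmax M0 TM Bc; apply: mconst_le => k z TBz; rewrite lee_fin.
case: minmax => [minF|maxE].
  rewrite minF; apply: bigmax_rnorm_le => i; have [b Bb <-] := TBz i.
  apply: le_trans (TM b) _; rewrite ler_pM2l // -lee_fin.
  exact: le_trans (rnorm_le_mconst _ Bb) Bc.
(* Lift [z] entrywise to a tuple of [B], to which the estimate for the maximum multi-norm
   applies. *)
have /choice[x xP] : forall i, exists b, B b /\ T b = z i.
  by move=> i; have [b] := TBz i; exists b.
have -> : z = [ffun i => T ([ffun i => x i] i)].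
  by apply/ffunP => i; rewrite !ffunE (xP i).2.
apply: le_trans (is_max_mnorm_image maxE M0 TM _) _.
rewrite ler_pM2l // -lee_fin; apply: le_trans Bc; apply: mnorm_le_mconst => i.
by rewrite ffunE; apply: (xP i).1.
Qed.

(** Raising the bound to at least 1 makes it invertible, as the pullback constant [M^-1]
    requires. *)
Lemma bounded_operator_pos :
  bounded_operator T ->
  exists2 M : R, 0 < M & forall x, rnorm (T x) <= M * rnorm x.
Proof.
move=> [M TM]; exists (Num.max M 1) => [|x].
  by rewrite lt_max ltr01 orbT.
apply: le_trans (TM x) _; apply: ler_wpM2r; first exact: rnorm_ge0.
by rewrite le_max lexx.
Qed.

Lemma bounded_multi_bounded :
    is_min_multinorm NF \/ is_max_multinorm NE ->
  bounded_operator T -> multi_bounded NE NF T.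
Proof.
move=> minmax /bounded_operator_pos[M M0 TM] B /multi_bounded_setP[c Bc].
by apply/multi_bounded_setP; exists (M * c); apply: mconst_image_le.
Qed.

Lemma unbounded_witness (e r : R) :
    ~ bounded_operator T -> 0 < e ->
  exists x, rnorm x <= e /\ r <= rnorm (T x).
Proof.
(* With the ratio [|r| / e], rescaling [x] to norm exactly [e] makes the norm of its image exceed
   [|r|]. *)
move=> nT e0; have /existsNP[x /negP] := (forallNP _).2 nT (`|r| / e).
rewrite -ltNge => Tx.
have x0 : 0 < rnorm x.
  rewrite lt_neqAle rnorm_ge0 andbT eq_sym; apply/eqP => /rnorm0_eq0 x0.
  by move: Tx; rewrite x0 linear0 !rnorm0 mulr0 ltxx.
have a0 : 0 <= e / rnorm x by rewrite divr_ge0 // ltW.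
exists (((e / rnorm x)%:C)%C *: x); rewrite linearZ !rnormZ rnorm_real //.
rewrite divfK ?gt_eqF //; split=> //.
apply: le_trans (ler_norm r) _; rewrite mulrAC ler_pdivlMr //.
by rewrite -ler_pdivrMl // mulrA [e^-1 * _]mulrC ltW.
Qed.

(* An unbounded operator is unbounded on some sequence of norms at most
   [2^-n], whose range is multi-bounded by the triangle inequality. *)
Lemma multi_bounded_bounded : multi_bounded NE NF T -> bounded_operator T.
Proof.
move=> mbT; apply: contrapT => nT.
have /choice[y yP] (n : nat) :
    exists x, rnorm x <= 2^-1 ^+ n /\ n%:R <= rnorm (T x).
  by apply: unbounded_witness => //; rewrite exprn_gt0.
have /mbT/multi_bounded_setP[c yc] : multi_bounded_set NE (range y).
  (* The constant 2 is the sum of the series of the 2^-n. *)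
  apply/multi_bounded_setP; exists 2; apply: mconst_le => k x yx.
  have /choice[f fP] i : exists n, y n = x i by have [n _] := yx i; exists n.
  have -> : x = [ffun i => y (f i)] by apply/ffunP => i; rewrite ffunE fP.
  have fm i : (f i < (\max_(j < k.+1) f j).+1)%N by rewrite ltnS leq_bigmax.
  rewrite lee_fin; apply: le_trans (mnorm_le_sum_range NE y fm) _.
  move: (_.+1) => m.
  (* The exact geometric partial sum is what makes the induction go through; the bound 2 alone would
     not. *)
  have sm : \sum_(n < m) rnorm (y n) <= 2 * (1 - 2^-1 ^+ m).
    elim: m => [|m IHm]; first by rewrite big_ord0 expr0 subrr mulr0.
    rewrite big_ord_recr /=; apply: le_trans (lerD IHm (yP m).1) _.
    by rewrite exprS !mulrBr mulrA divff // mul1r mulr1 mulr_natl mulr2n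
      opprD addrA addrNK.
  by apply: le_trans sm _; rewrite ler_piMr // gerBl.
(* Some n exceeds [|c|], whereas n is at most the norm of [T (y n)], which is at most [c]. *)
have := archi_boundP (normr_ge0 c); set n := Num.bound _ => cn.
have : ((rnorm (T (y n)))%:E <= c%:E)%E.
  by apply: le_trans yc; apply: rnorm_le_mconst; exists (y n) => //; exists n.
rewrite lee_fin => Tyc; have := le_lt_trans (ler_norm c) cn.
by rewrite ltNge (le_trans (yP n).2 Tyc).
Qed.

Lemma op_norm_le_mb_norm : (op_norm T <= mb_norm NE NF T)%E.
Proof.
apply: ge_ereal_sup => _ [x /= x1 <-]; apply: ereal_sup_ubound.
exists [set x]; last by rewrite image_set1 mconst_set1.
by rewrite /= /multi_bounded_set mconst_set1 ltry lee_fin.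
Qed.

(** For nonzero [x], apply the supremum to [x] divided by its norm. *)
Lemma rnorm_le_op_norm (L : R) :
  op_norm T = L%:E -> forall x, rnorm (T x) <= L * rnorm x.
Proof.
move=> TL x; have [/rnorm0_eq0 ->|x0] := eqVneq (rnorm x) 0.
  by rewrite linear0 !rnorm0 mulr0.
have xp : 0 < rnorm x by rewrite lt_neqAle rnorm_ge0 eq_sym x0.
have xi0 : 0 <= (rnorm x)^-1 by rewrite invr_ge0 ltW.
have : ((rnorm (T (((rnorm x)^-1%:C)%C *: x)))%:E <= op_norm T)%E.
  apply: ereal_sup_ubound; exists (((rnorm x)^-1%:C)%C *: x) => //=.
  by rewrite rnormZ rnorm_real // mulVf.
by rewrite TL lee_fin linearZ rnormZ rnorm_real // ler_pdivrMl // mulrC.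
Qed.

(** The vector 0 in the unit ball rules out -oo, and any bound of [T] rules out +oo. *)
Lemma op_norm_fin : bounded_operator T -> exists2 L, 0 <= L & op_norm T = L%:E.
Proof.
move=> /bounded_operator_pos[M M0 TM].
have le0 : (0 <= op_norm T)%E.
  by apply: ereal_sup_ubound; exists 0; rewrite /= ?linear0 rnorm0.
have leM : (op_norm T <= M%:E)%E.
  apply: ge_ereal_sup => _ [x /= x1 <-]; rewrite lee_fin.
  by apply: le_trans (TM x) _; rewrite ler_piMr // ltW.
by case: (op_norm T) le0 leM => [L L0 _|//|//]; exists L.
Qed.

Lemma mb_norm_le_op_norm :
    is_min_multinorm NF \/ is_max_multinorm NE -> bounded_operator T ->
  (mb_norm NE NF T <= op_norm T)%E.
Proof.
move=> minmax /op_norm_fin[L L0 TL]; rewrite TL; apply/lee_addgt0Pr => e e0.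
apply: ge_ereal_sup => _ [B [_ B1] <-].
(* [L] may be 0 while [mconst_image_le] asks for a positive bound; [L + e] is one, and it is used
   with c = 1. *)
rewrite -EFinD -[L + e]mulr1; apply: mconst_image_le => // [|x].
  exact: ltr_wpDl.
apply: le_trans (rnorm_le_op_norm TL x) _; apply: ler_wpM2r.
  exact: rnorm_ge0.
by rewrite lerDl ltW.
Qed.

End MultiBounded.

Theorem theorem6p17 (R : realType) (E F : normedModType R[i])
    (NE : multinorm E) (NF : multinorm F)
    (hmin_or_max : is_min_multinorm NF \/ is_max_multinorm NE) :
  [set T : {linear E -> F} | multi_bounded NE NF T] =
    [set T : {linear E -> F} | bounded_operator T] /\
  (forall T : {linear E -> F}, bounded_operator T ->
    mb_norm NE NF T = op_norm T).
Proof.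
split=> [|T bT].
  apply/seteqP; split=> T; first exact: multi_bounded_bounded.
  exact: bounded_multi_bounded.
apply/eqP; rewrite eq_le mb_norm_le_op_norm //.
exact: op_norm_le_mb_norm.
Qed.
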